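(* Let $\mathbb{K}\in\{\mathbb{R},\mathbb{C}\}$, let $S\subseteq\mathbb{K}$ be finite, and let $f\in\mathbb{K}[x_1,\dots,x_n]$ be homogeneous of degree $d$. Consider the following algorithm: pick $R\in M_n(\mathbb{K})$ with entries chosen uniformly and independently at random from $S$, set $h(x)=f(Rx)$ and compute the slices $T_{\bar1},T_{\bar2},T_{\bar3}$ of $h$. If $T_{\bar1}$ is singular, reject. Otherwise let $T_{\bar1}'=T_{\bar1}^{-1}$; if $T_{\bar1}'T_{\bar2}$ and $T_{\bar1}'T_{\bar3}$ do not commute or $T_{\bar1}'T_{\bar2}$ is not diagonalisable over $\mathbb{K}$, reject; otherwise diagonalise $T_{\bar1}'T_{\bar2}=P\Lambda P^{-1}$ (with $P$ invertible and $\Lambda$ diagonal), let $l_i$ be the linear form given by the $i$-th row of $R^{-1}P^{-1}$, let $\alpha_i$ be the value at the $i$-th standard basis vector $e_i$ of the polynomial $x\mapsto f(PRx)$, and output $\{(\alpha_1,l_1),\dots,(\alpha_n,l_n)\}$. Then: (i) if $f$ is not equivalent to any polynomial in $\mathcal{P}_d$, the algorithm rejects with probability at least $1-\frac{2(d-2)}{|S|}$; (ii) if $f$ is equivalent to some polynomial in $\mathcal{P}_d$, then with probability at least $1-\left(\frac{2\binom{n}{2}(d-2)}{|S|}+\frac{n(d-1)}{|S|}\right)$ the algorithm outputs linearly independent linear forms $l_1,\dots,l_n$ and coefficients $\alpha_i\neq0$ such that $f=\sum_{i=1}^n\alpha_il_i^d$.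
   Context: Slices: for a degree-$d$ form $g$ in $n$ variables with symmetric tensor $(T_{i_1\dots i_d})$ (the unique symmetric tensor with $g=\sum T_{i_1\dots i_d}x_{i_1}\cdots x_{i_d}$), the slice $T_{i_1\dots i_{d-2}}$ is the matrix with $(i_{d-1},i_d)$ entry $T_{i_1\dots i_d}$, and $T_{\bar k}=T_{k\dots k}$. $\mathcal{P}_d$ is the set of polynomials $\sum_{i=1}^n\alpha_ix_i^d$ with all $\alpha_i\in\mathbb{K}\setminus\{0\}$. $f$ is equivalent to $g$ if $f(x)=g(Ax)$ for some invertible $A\in M_n(\mathbb{K})$.
   Formalization: The output uses the rows of P^{-1}R^{-1} and the values of f(RPx) at e_i, since with R^{-1}P^{-1} and f(PRx) part (ii) is false; n ≥ 3 (so that T_3 exists), d ≥ 3 (for d = 2 part (ii) fails) and S nonempty are assumed. *)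

(* Defs.v *)
From mathcomp Require Export all_boot all_order all_fingroup all_algebra.
From mathcomp Require Export complex finmap mpoly.
(* The notations of MathComp-Analysis clash with those of mpoly. *)
From mathcomp Require Export -(notations) boolp classical_sets reals.

Set Implicit Arguments.
Unset Strict Implicit.
Unset Printing Implicit Defensive.

Import GRing.Theory Num.Theory.
Local Open Scope ring_scope.

Section Forms.
Variables (K : fieldType) (n : nat).

Definition linform (l : 'rV[K]_n) : {mpoly K[n]} :=
  \sum_(j < n) l 0 j *: 'X_j.

(* The polynomial x |-> f (A x), where x is a column vector. *)
Definition lsubst (A : 'M[K]_n) (f : {mpoly K[n]}) : {mpoly K[n]} :=
  f \mPo [tuple linform (row i A) | i < n].

Definition equivalent (f g : {mpoly K[n]}) : Prop :=
  exists2 A : 'M[K]_n, A \in unitmx & f = lsubst A g.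

Definition in_Pd (d : nat) (g : {mpoly K[n]}) : Prop :=
  exists2 a : 'I_n -> K,
    forall i, a i != 0 & g = \sum_(i < n) a i *: 'X_i ^+ d.

(* Order-d tensors, indexed by multi-indices t : 'I_d -> 'I_n. *)
Definition tensor (d : nat) := {ffun {ffun 'I_d -> 'I_n} -> K}.

Definition symmetric_tensor_of (d : nat) (g : {mpoly K[n]}) (T : tensor d)
    : Prop :=
  (forall (s : 'S_d) (t : {ffun 'I_d -> 'I_n}), T [ffun p => t (s p)] = T t) /\
  g = \sum_(t : {ffun 'I_d -> 'I_n}) T t *: \prod_(p < d) 'X_(t p).

(* "The" symmetric tensor of g; existence and uniqueness, for g homogeneous of
   degree d in characteristic 0, are sym_tensorP and sym_tensor_uniq below. *)
Definition sym_tensor (d : nat) (g : {mpoly K[n]}) : tensor d :=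
  xget [ffun=> 0] (symmetric_tensor_of g).

(* T_{i_1 ... i_(d-2)}; for d >= 2 the list s ++ [:: i; j] has length d, so the
   default value of nth is not used. *)
Definition slice (d : nat) (T : tensor d) (s : (d - 2).-tuple 'I_n) :
    'M[K]_n :=
  \matrix_(i, j) T [ffun p : 'I_d => nth i (s ++ [:: i; j]) p].

Definition bar_slice (d : nat) (g : {mpoly K[n]}) (k : 'I_n) : 'M[K]_n :=
  slice (sym_tensor d g) [tuple of nseq (d - 2) k].

Definition mon (d : nat) (t : {ffun 'I_d -> 'I_n}) : 'X_{1..n} :=
  (\sum_(p < d) U_(t p))%MM.

Lemma mcoeff_tensor d (T : tensor d) m :
  (\sum_(t : {ffun 'I_d -> 'I_n}) T t *: \prod_(p < d) 'X_(t p))@_m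
  = \sum_(t | mon t == m) T t.
Proof.
rewrite raddf_sum /= [RHS]big_mkcond; apply: eq_bigr => t _.
by rewrite mprodXE mcoeffZ mcoeffX; case: ifP => _; rewrite ?mulr1 ?mulr0.
Qed.

Lemma mon_perm d (t : {ffun 'I_d -> 'I_n}) (s : 'S_d) :
  mon [ffun p => t (s p)] = mon t.
Proof.
rewrite /mon [RHS](reindex_inj (@perm_inj _ s)).
by apply: eq_bigr => p _; rewrite ffunE.
Qed.

Lemma monE d (t : {ffun 'I_d -> 'I_n}) i :
  mon t i = count_mem i [tuple t p | p < d].
Proof.
rewrite mnm_sumE count_map -sum1_count big_enum_cond /= [RHS]big_mkcond /=.
by apply: eq_bigr => p _; rewrite mnm1E; case: (t p == i).
Qed.

Lemma mon_inj d (t u : {ffun 'I_d -> 'I_n}) : mon t = mon u ->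
  exists s : 'S_d, t = [ffun p => u (s p)].
Proof.
move=> tu.
have /tuple_permP[s st] : perm_eq [tuple t p | p < d] [tuple u p | p < d].
  by apply/allP => i _; apply/eqP; rewrite -!monE tu.
exists s; apply/ffunP => p; rewrite ffunE.
have := congr1 (fun r => nth (t p) r p) st.
rewrite -(tnth_nth _ [tuple t p | p < d]) tnth_mktuple => ->.
by rewrite -tnth_nth !tnth_mktuple.
Qed.

Lemma mon_surj d (m : 'X_{1..n}) : mdeg m = d ->
  exists t : {ffun 'I_d -> 'I_n}, mon t = m.
Proof.
move=> md; pose s := flatten [seq nseq (m i) i | i <- enum 'I_n].
have sz : size s == d.
  rewrite -md mdegE size_flatten /shape -map_comp sumnE big_map big_enum /=.
  by apply/eqP/eq_bigr => i _; rewrite /= size_nseq.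
exists [ffun p => tnth (Tuple sz) p]; apply/mnmP => i; rewrite monE.
have -> : [tuple [ffun p => tnth (Tuple sz) p] p | p < d] = Tuple sz.
  by apply: eq_from_tnth => p; rewrite tnth_mktuple ffunE.
rewrite /= count_flatten -map_comp sumnE big_map big_enum /= (bigD1 i) //=.
rewrite count_nseq /= eqxx mul1n big1 ?addn0 // => j /negPf nji.
by rewrite count_nseq /= nji.
Qed.

Lemma sym_tensor_uniq d g (T U : tensor d) : [pchar K] =i pred0 ->
  symmetric_tensor_of g T -> symmetric_tensor_of g U -> T = U.
Proof.
move=> /pcharf0P K0 [sT gT] [sU gU].
have fib (V : tensor d) t : (forall (s : 'S_d) (t : {ffun 'I_d -> 'I_n}),
    V [ffun p => t (s p)] = V t) ->
    \sum_(u | mon u == mon t) V u = V t *+ 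
      #|[pred u : {ffun 'I_d -> 'I_n} | mon u == mon t]|.
  move=> sV; rewrite -sumr_const; apply: eq_bigr => u /eqP /mon_inj[s ->].
  exact: sV.
apply/ffunP => t.
have : \sum_(u | mon u == mon t) T u = \sum_(u | mon u == mon t) U u.
  by rewrite -!mcoeff_tensor -gT -gU.
rewrite !fib // -mulr_natr -[RHS]mulr_natr; apply: mulIf.
by rewrite K0 -lt0n; apply/card_gt0P; exists t; rewrite inE.
Qed.

Lemma sym_tensorP d g : [pchar K] =i pred0 -> g \is d.-homog ->
  symmetric_tensor_of g (sym_tensor d g).
Proof.
move=> /pcharf0P K0 hg; rewrite /sym_tensor.
pose N m := #|[pred u : {ffun 'I_d -> 'I_n} | mon u == m]|.
pose T : tensor d := [ffun t => g@_(mon t) / (N (mon t))%:R].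
suff : symmetric_tensor_of g T by move=> PT; apply: xgetPex; exists T.
split=> [s t|]; first by rewrite !ffunE mon_perm.
apply/mpolyP => m; rewrite mcoeff_tensor.
under eq_bigr => t /eqP tm do rewrite ffunE tm.
rewrite sumr_const -/(N m) -[RHS]mulr_natr.
have [md|md] := eqVneq (mdeg m) d; last first.
  by rewrite (dhomog_nemf_coeff hg md) !mul0r.
have [t tm] := mon_surj md.
rewrite divfK // K0 -lt0n; apply/card_gt0P; exists t.
by rewrite inE tm.
Qed.

End Forms.

Section Algorithm.
Variables (K : fieldType) (n : nat) (hn : (3 <= n)%N).

(* The indices 1, 2, 3, which are 0, 1, 2 in 'I_n. *)
Definition k1 : 'I_n := Ordinal (ltnW (ltnW hn)).
Definition k2 : 'I_n := Ordinal (ltnW hn).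
Definition k3 : 'I_n := Ordinal hn.

Inductive outcome : Type :=
| Reject
| Output of ('I_n -> K * 'rV[K]_n).

(* alg_run d f R o: the algorithm may end with outcome o on the input f when it
   has drawn R. This is a relation because "diagonalise" does not determine P
   and Lambda: every diagonalisation is allowed.
   As f (R P x) = h (P x) is the diagonal form, the linear forms are the rows of
   (R P)^-1 = P^-1 R^-1 and the coefficients are the values f (R P e_i). *)
Inductive alg_run (d : nat) (f : {mpoly K[n]}) (R : 'M[K]_n) :
    outcome -> Prop :=
| RejectSingular :
    bar_slice d (lsubst R f) k1 \notin unitmx ->
    alg_run d f R Reject
| RejectNotCommOrNotDiag :
    let h := lsubst R f in
    let T1' := invmx (bar_slice d h k1) in
    let T2 := bar_slice d h k2 in
    let T3 := bar_slice d h k3 in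
    bar_slice d h k1 \in unitmx ->
    ~ comm_mx (T1' *m T2) (T1' *m T3) \/ ~ diagonalizable (T1' *m T2) ->
    alg_run d f R Reject
| Diagonalise (P Lambda : 'M[K]_n) :
    let h := lsubst R f in
    let T1' := invmx (bar_slice d h k1) in
    let T2 := bar_slice d h k2 in
    let T3 := bar_slice d h k3 in
    bar_slice d h k1 \in unitmx ->
    comm_mx (T1' *m T2) (T1' *m T3) ->
    P \in unitmx -> is_diag_mx Lambda ->
    T1' *m T2 = P *m Lambda *m invmx P ->
    alg_run d f R (Output (fun i =>
      ((lsubst (R *m P) f).@[fun j => (j == i)%:R],
       row i (invmx P *m invmx R)))).

Definition rejects (d : nat) (f : {mpoly K[n]}) (R : 'M[K]_n) : Prop :=
  forall o, alg_run d f R o -> o = Reject.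

Definition outputs_decomposition (d : nat) (f : {mpoly K[n]}) (R : 'M[K]_n) :
    Prop :=
  forall o, alg_run d f R o ->
    exists2 al : 'I_n -> K * 'rV[K]_n, o = Output al &
      [/\ row_free (\matrix_(i < n) (al i).2),
          forall i, (al i).1 != 0 &
          f = \sum_(i < n) (al i).1 *: linform (al i).2 ^+ d].

(* Hence neither of the two predicates above can hold vacuously. *)
Lemma alg_run_total d f R : exists o, alg_run d f R o.
Proof.
have [u1|nu1] := boolP (bar_slice d (lsubst R f) k1 \in unitmx); last first.
  by exists Reject; apply: RejectSingular.
pose A := invmx (bar_slice d (lsubst R f) k1) *m bar_slice d (lsubst R f) k2.
pose B := invmx (bar_slice d (lsubst R f) k1) *m bar_slice d (lsubst R f) k3.
have [cAB|ncAB] := pselect (comm_mx A B); last first.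
  by exists Reject; apply: RejectNotCommOrNotDiag => //; left.
have [dA|ndA] := pselect (diagonalizable A); last first.
  by exists Reject; apply: RejectNotCommOrNotDiag => //; right.
case: dA => Q uQ /similar_diagPex [D /(similarP uQ) QA].
eexists; apply: (@Diagonalise d f R (invmx Q) (diag_mx D)) => //.
  by rewrite unitmx_inv.
by rewrite invmxK -mulmxA -QA mulKmx.
Qed.

End Algorithm.

(* Probability of the event E for a matrix whose entries are independent and
   uniform on S; its values are taken in F. *)
Definition prob_mx (F : realFieldType) (K : fieldType) (S : {fset K}) (n : nat)
    (E : 'M[K]_n -> Prop) : F :=
  \sum_(M : 'M[S]_n | asbool (E (map_mx val M)))
    \prod_(i < n) \prod_(j < n) (#|` S|%:R)^-1.

(* Main.v *)
Require Import Defs.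
From mathcomp Require Import zify ring.

(** Write [F u] for the Hessian of [f] at [u], up to the factor [d (d - 1)].  The
    slice [k] of [f (R x)] is [R^T F(r_k) R], where [r_k] is column [k] of [R],
    so that the algorithm tests whether [F(r_1)^-1 F(r_2)] is diagonalisable and
    commutes with [F(r_1)^-1 F(r_3)].

    Part (i).  Fix [r_1] with [F(r_1)] invertible, and let [A_s] be the slices of
    [f] multiplied by [F(r_1)^-1].  If [F(r_1)^-1 F(r_2)] does not commute with
    some [A_s], then commuting with [F(r_1)^-1 F(r_3)] is a nonzero polynomial
    condition of degree [d - 2] on [r_3].  Otherwise, the diagonalisable matrices
    [F(r_1)^-1 F(r_2)] that commute with all [A_s] span a space of commuting
    diagonalisable matrices.  If it contained all [A_s], these would be
    diagonalised by one matrix, in whose basis the symmetry of the tensor makes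
    [f] a sum of powers; hence [r_2] satisfies a nonzero polynomial condition of
    degree [d - 2].

    Part (ii).  If [f (x) = g (A x)] and [C = A R], slice [k] is
    [C^T diag(a_i C_ik^(d-2)) C], and the algorithm succeeds as soon as [R] is
    invertible, the first column of [C] has no zero entry and the numbers
    [(C_i2 / C_i1)^(d-2)] are distinct.

    All probabilities are bounded by the Schwartz-Zippel lemma applied to one
    column conditionally on the others. *)

Set Implicit Arguments.
Unset Strict Implicit.
Unset Printing Implicit Defensive.
Import Order.TTheory GRing.Theory Num.Theory.
Local Open Scope ring_scope.

(** * The Schwartz-Zippel lemma *)

Section SchwartzZippel.
Variable K : fieldType.
Local Notation widen := (widen_ord (leqnSn _)).

Lemma mnm_rcons_widen n (m : 'X_{1..n}) k i :
  [multinom of rcons m k] (widen i) = m i.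
Proof. by rewrite !(mnm_nth 0%N) nth_rcons size_tuple /= ltn_ord. Qed.

Lemma mnm_rcons_max n (m : 'X_{1..n}) k : [multinom of rcons m k] ord_max = k.
Proof. by rewrite (mnm_nth 0%N) nth_rcons size_tuple /= ltnn eqxx. Qed.

Lemma mnm_rconsE n (m : 'X_{1..n.+1}) :
  m = [multinom of rcons [multinom m (widen i) | i < n] (m ord_max)].
Proof.
apply/mnmP => i; have [ltin|lein] := ltnP i n.
  have -> : i = widen (Ordinal ltin) by apply: val_inj.
  by rewrite mnm_rcons_widen mnmE.
have -> : i = ord_max by apply: val_inj => /=; have := ltn_ord i; lia.
by rewrite mnm_rcons_max.
Qed.

(** [muni] regards [p] as a polynomial in the last variable; this identity lets the induction below
    compare the support and degree of [p] with those of its coefficients. *)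
Lemma mcoeff_muni n (p : {mpoly K[n.+1]}) k (m : 'X_{1..n}) :
  ((muni p)`_k)@_m = p@_[multinom of rcons m k].
Proof.
have rc (m' : 'X_{1..n.+1}) :
    ([multinom m' (widen i) | i < n] == m) && (k == m' ord_max)
    = (m' == [multinom of rcons m k]).
  apply/andP/eqP => [[/eqP <- /eqP ->]|->]; first exact: mnm_rconsE.
  rewrite mnm_rcons_max; split=> //.
  by apply/eqP/mnmP => i; rewrite mnmE mnm_rcons_widen.
rewrite muniE coef_sum raddf_sum /=.
under eq_bigr => m' _.
  rewrite coefZ coefXn mulr_natr raddfMn /= mcoeffZ mcoeffX -mulrnAr -mulrnA.
  rewrite mulnb rc.
  over.
have [mp|mp] := boolP ([multinom of rcons m k] \in msupp p).
  rewrite (bigD1_seq _ mp) ?msupp_uniq //= eqxx mulr1 big1 ?addr0 //.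
  by move=> m' /negPf ->; rewrite mulr0.
rewrite (memN_msupp_eq0 mp) big_seq big1 // => m' m'p.
by case: eqP => [e|_]; rewrite ?mulr0 //; rewrite e (negPf mp) in m'p.
Qed.

Lemma meval_muni n (p : {mpoly K[n.+1]}) (v : 'I_n.+1 -> K) :
  p.@[v] = (map_poly (meval (fun i => v (widen i))) (muni p)).[v ord_max].
Proof.
rewrite mevalE muniE raddf_sum /= horner_sum; apply: eq_bigr => m _.
rewrite map_polyZ /= map_polyXn hornerZ hornerXn mevalZ mevalX.
rewrite big_ord_recr /= mulrA; congr (_ * _ * _).
by apply: eq_bigr => i _; rewrite mnmE.
Qed.

Lemma card_roots (T : finType) (h : T -> K) (q : {poly K}) k :
  injective h -> q != 0 -> (size q <= k.+1)%N ->
  (#|[pred s | q.[h s] == 0%R]| <= k)%N.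
Proof.
move=> hI q0 szq; rewrite -ltnS (leq_trans _ szq) //.
rewrite -(size_image h); apply: max_poly_roots => //.
  by apply/allP => _ /mapP[s + ->]; rewrite mem_enum.
by rewrite map_inj_uniq ?enum_uniq.
Qed.

(** Induction on the number of variables. Let [p] have degree [k] and leading coefficient [c] in the
    last variable: [c] has few zeros by induction, and away from them at most [k] values of the last
    coordinate give a zero of [p]. *)
Lemma schwartz_zippel (T : finType) (h : T -> K) n (p : {mpoly K[n]}) D :
  injective h -> p != 0 -> (msize p <= D.+1)%N ->
  (#|[pred v : {ffun 'I_n -> T} | p.@[fun i => h (v i)] == 0%R]| * #|T|
    <= D * #|T| ^ n)%N.
Proof.
move=> hI; elim: n p D => [|n IHn] p D p0 szp.
  rewrite eq_card0 // => v; rewrite inE; apply: contraNF p0 => /eqP pv.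
  have m0 (m : 'X_{1..0}) : m = 0%MM by apply/mnmP; case.
  have pC : p = (p@_0)%:MP.
    by apply/mpolyP => m'; rewrite (m0 m') mcoeffC eqxx mulr1.
  by rewrite pC mevalC in pv; rewrite pC pv mpolyC0.
set k := (size (muni p)).-1.
have q0 : muni p != 0.
  apply: contra p0 => /eqP q0; apply/eqP/mpolyP => m.
  by rewrite (mnm_rconsE m) -mcoeff_muni q0 coef0 !mcoeff0.
have szq : (size (muni p) = k.+1)%N by rewrite prednK // size_poly_gt0.
set c := (muni p)`_k; have c0 : c != 0 by rewrite -[c]lead_coefE lead_coef_eq0.
have degc m : m \in msupp c -> (mdeg m + k <= D)%N.
  rewrite mcoeff_msupp mcoeff_muni -mcoeff_msupp => /msize_mdeg_lt ltm.
  have := leq_trans ltm szp; rewrite ltnS; congr (_ <= _)%N.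
  rewrite !mdegE big_ord_recr /= mnm_rcons_max; congr (_ + _)%N.
  by apply: eq_bigr => i _; rewrite mnm_rcons_widen.
have kD : (k <= D)%N by have := degc _ (mlead_supp c0); lia.
have szc : (msize c <= (D - k).+1)%N.
  rewrite msizeE; apply/bigmax_leqP_seq => m mc _.
  by have := degc _ mc; lia.
pose Z := [pred w : {ffun 'I_n -> T} | c.@[fun i => h (w i)] == 0].
(* A point with [n.+1] coordinates is a pair of its first [n] coordinates and its last one. *)
pose ext (ws : {ffun 'I_n -> T} * T) : {ffun 'I_n.+1 -> T} :=
  [ffun i => if unlift ord_max i is Some j then ws.1 j else ws.2].
have ext_max ws : ext ws ord_max = ws.2 by rewrite ffunE unlift_none.
have ext_widen ws i : ext ws (widen i) = ws.1 i.
  have -> : widen i = lift ord_max i.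
    by apply: val_inj; rewrite /= /bump leqNgt ltn_ord.
  by rewrite ffunE liftK.
have ext_bij : bijective ext.
  exists (fun v : {ffun 'I_n.+1 -> T} => ([ffun i => v (widen i)], v ord_max)).
    move=> [w s]; rewrite ext_max; congr (_, _).
    by apply/ffunP => i; rewrite ffunE ext_widen.
  move=> v; apply/ffunP => i; rewrite ffunE /=.
  case: unliftP => [j ->|->] //; rewrite ffunE; congr (v _).
  by apply: val_inj; rewrite /= /bump leqNgt ltn_ord.
have cnt : (#|[pred v : {ffun 'I_n.+1 -> T} | p.@[fun i => h (v i)] == 0%R]|
    <= k * #|T| ^ n + #|Z| * #|T|)%N.
  rewrite -sum1_card (reindex ext) /=; last exact: onW_bij.
  rewrite big_mkcond /= (eq_bigr (fun ws : {ffun 'I_n -> T} * T =>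
    if p.@[fun i => h (ext (ws.1, ws.2) i)] == 0 then 1%N else 0%N)); last first.
    by case.
  rewrite -(pair_bigA _ (fun w s =>
    if p.@[fun i => h (ext (w, s) i)] == 0 then 1%N else 0%N)) /=.
  have -> : (k * #|T| ^ n + #|Z| * #|T| =
      \sum_(w : {ffun 'I_n -> T}) (k + (w \in Z) * #|T|))%N.
    rewrite big_split /= sum_nat_const card_ffun card_ord mulnC -big_distrl /=.
    congr (_ + _ * _)%N; rewrite -sum1_card big_mkcond.
    by apply: eq_bigr => w _; case: (w \in Z).
  apply: leq_sum => w _; rewrite -big_mkcond sum1_card.
  (* Above a zero [w] of [c] every last coordinate is counted; otherwise [q] is nonzero of degree at
     most [k]. *)
  have [wZ|wZ] := boolP (w \in Z).
    by rewrite mul1n (leq_trans (max_card _)) // leq_addl.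
  rewrite mul0n addn0.
  pose q := map_poly (meval (fun i => h (w i))) (muni p).
  have qk : q`_k != 0 by rewrite coef_map.
  rewrite (@eq_card _ _ [pred s | q.[h s] == 0]); last first.
    move=> s; rewrite -!topredE /= meval_muni ext_max; congr (_.[_] == 0).
    by apply: eq_map_poly => r; apply: meval_eq => i; rewrite ext_widen.
  apply: card_roots => //; first by apply: contraNneq qk => ->; rewrite coef0.
  by rewrite -szq; apply: size_poly.
have := IHn _ _ c0 szc; rewrite -/Z => HZ.
apply: (leq_trans (leq_mul cnt (leqnn _))).
have : (#|Z| * #|T| * #|T| <= (D - k) * #|T| ^ n * #|T|)%N by rewrite leq_mul.
rewrite -{2}(subnK kD) mulnDl expnSr.
lia.
Qed.
End SchwartzZippel.

(** * Matrices with independent uniform entries *)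

Definition setcol (T : Type) n (k : 'I_n) (v : 'I_n -> T) (M : 'M[T]_n) :
    'M[T]_n :=
  \matrix_(i, j) if j == k then v i else M i j.

Section RandomMatrix.
Variables (F : realFieldType) (K : fieldType) (S : {fset K}) (n : nat).
Hypothesis S0 : S != fset0.
Implicit Types E : 'M[K]_n -> Prop.

Let good E (M : 'M[S]_n) := asbool (E (map_mx val M)).

Let cardS_neq0 : #|` S|%:R != 0 :> F.
Proof. by rewrite pnatr_eq0 cardfs_eq0. Qed.

Lemma prob_mxE E : prob_mx F S E = #|good E|%:R / #|` S|%:R ^+ (n * n).
Proof.
rewrite /prob_mx; under eq_bigr do
  rewrite prodr_const prodr_const card_ord -exprM exprVn.
by rewrite sumr_const mulr_natl.
Qed.

Lemma prob_mx_le E1 E2 : (forall M, E1 M -> E2 M) ->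
  prob_mx F S E1 <= prob_mx F S E2.
Proof.
move=> E12; rewrite !prob_mxE ler_wpM2r ?invr_ge0 ?exprn_ge0 ?ler0n //.
rewrite ler_nat; apply: subset_leq_card; apply/fintype.subsetP => M.
by rewrite -!topredE => /asboolP EM; apply/asboolP/E12.
Qed.

Lemma prob_mxU E1 E2 :
  prob_mx F S (fun M => E1 M \/ E2 M) <= prob_mx F S E1 + prob_mx F S E2.
Proof.
rewrite !prob_mxE -mulrDl -natrD ler_wpM2r ?invr_ge0 ?exprn_ge0 ?ler0n //.
rewrite ler_nat -cardUI; apply: leq_trans (leq_addr _ _).
apply: subset_leq_card; apply/fintype.subsetP => M; move=> EM.
by case: (asboolW EM) => ?; apply/orP; [left|right]; apply/asboolP.
Qed.

Lemma prob_mx0 E : (forall M, ~ E M) -> prob_mx F S E = 0.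
Proof.
move=> nE; rewrite prob_mxE eq_card0 ?mul0r // => M; rewrite -topredE.
by apply/negbTE/asboolPn/nE.
Qed.

Lemma prob_mx_bigU (I : finType) (P : pred I) (E : I -> 'M[K]_n -> Prop) :
  prob_mx F S (fun M => exists2 i, P i & E i M)
  <= \sum_(i | P i) prob_mx F S (E i).
Proof.
have sumE (r : seq I) :
    prob_mx F S (fun M => exists i, [/\ i \in r, P i & E i M])
    <= \sum_(i <- r | P i) prob_mx F S (E i).
  elim: r => [|i r IHr].
    by rewrite big_nil prob_mx0 // => M [i []].
  rewrite big_cons; case: ifP => Pi; last first.
    apply: le_trans IHr; apply: prob_mx_le => M [j []].
    rewrite inE => /orP[/eqP->|jr Pj Ej]; first by rewrite Pi.
    by exists j.
  apply: le_trans (lerD (lexx _) IHr); apply: le_trans (prob_mxU _ _).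
  apply: prob_mx_le => M [j []]; rewrite inE => /orP[/eqP->|jr Pj Ej].
    by left.
  by right; exists j.
apply: le_trans (sumE _); apply: prob_mx_le => M [i Pi Ei].
by exists i; rewrite mem_index_enum.
Qed.

(** Reduces a lower bound for success to an upper bound for a bad event [B] that covers every
    failure of [E]. *)
Lemma prob_mx_ge E B : (forall M, E M \/ B M) ->
  1 - prob_mx F S B <= prob_mx F S E.
Proof.
move=> EB; rewrite lerBlDr; apply: le_trans (prob_mxU _ _).
rewrite prob_mxE (@eq_card _ _ predT) => [|M]; last first.
  by rewrite -topredE; apply/asboolP.
by rewrite card_mx -cardfE natrX divff // expf_neq0.
Qed.

(* Schwartz-Zippel applied to one column, conditionally on the other ones. *)
Lemma prob_mx_col E (k : 'I_n) (D : nat) :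
  (forall M, exists p : {mpoly K[n]}, [/\ p != 0, (msize p <= D.+1)%N &
     forall v : 'I_n -> K, (forall i, v i \in S) -> E (setcol k v M) ->
       p.@[v] = 0]) ->
  prob_mx F S E <= D%:R / #|` S|%:R.
Proof.
(* [c M] counts the choices of column [k] for which the event holds, the other columns of [M] being
   held fixed. *)
move=> Ecol; pose c M := #|[pred v : {ffun 'I_n -> S} | good E (setcol k v M)]|.
have c_le M : (c M * #|` S| <= D * #|` S| ^ n)%N.
  have [p [p0 szp pE]] := Ecol (map_mx val M).
  rewrite cardfE; apply: leq_trans (schwartz_zippel (@val_inj _ _ S) p0 szp).
  rewrite leq_mul // subset_leq_card //; apply/fintype.subsetP => v.
  rewrite !inE => Ev; apply/eqP/pE => [i|]; first exact: valP.
  have <- : map_mx val (setcol k v M)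
      = setcol k (fun i => val (v i)) (map_mx val M).
    by apply/matrixP => i j; rewrite !mxE; case: (j == k).
  exact: Ev.
(* Exchanging column [k] with the vector is an involution on pairs, so summing [c] over all matrices
   counts each good matrix once for every vector. *)
pose sw (Mv : 'M[S]_n * {ffun 'I_n -> S}) :=
  (setcol k Mv.2 Mv.1, [ffun i => Mv.1 i k]).
have swK : involutive sw.
  move=> [M v]; rewrite /sw /=; congr (_, _).
    apply/matrixP => i j; rewrite !mxE ffunE; case: eqP => [->|] //.
  by apply/ffunP => i; rewrite ffunE mxE eqxx.
have cnt : (#|good E| * #|` S| ^ n = \sum_(M : 'M[S]_n) c M)%N.
  have -> : (#|` S| ^ n = #|{ffun 'I_n -> S}|)%N by rewrite card_ffun card_ord cardfE.
  rewrite -sum_nat_const; under [LHS]eq_bigr do rewrite -sum1_card.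
  under [RHS]eq_bigr do rewrite /c -sum1_card.
  rewrite !pair_big_dep /= [RHS](reindex_inj (inv_inj swK)) /=.
  apply: eq_bigl => -[M v] /=; rewrite -!topredE /= andbT.
  congr (good E); apply/matrixP => i j.
  by rewrite !mxE ffunE; case: eqP => [->|].
have := cardS_neq0; rewrite prob_mxE; set s := #|` S| in c_le cnt * => s_neq0.
have s_gt0 : 0 < s%:R :> F by rewrite lt0r s_neq0 ler0n.
rewrite ler_pdivrMr ?exprn_gt0 // -(ler_pM2r (exprn_gt0 n s_gt0)).
rewrite -(ler_pM2r s_gt0) -!natrX -!natrM cnt.
have -> : D%:R / s%:R * (s ^ (n * n))%:R * (s ^ n)%:R * s%:R
    = (D * s ^ n * s ^ (n * n))%:R :> F.
  by rewrite !natrM mulrAC [_ * _ * s%:R]mulrAC divfK // mulrAC.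
rewrite ler_nat big_distrl /=.
apply: (@leq_trans (\sum_(M : 'M[S]_n) D * s ^ n)%N); first exact: leq_sum.
by rewrite sum_nat_const card_mx -cardfE mulnC.
Qed.

End RandomMatrix.

(** * Symmetric tensors indexed by lists *)

Lemma big_tuple_cons (T : finType) (V : nmodType) e (G : seq T -> V) :
  \sum_(t : e.+1.-tuple T) G t = \sum_a \sum_(s : e.-tuple T) G (a :: s).
Proof.
rewrite pair_bigA /=.
rewrite (reindex (fun x : T * e.-tuple T => [tuple of x.1 :: x.2])) //=.
exists (fun t : e.+1.-tuple T => (thead t, [tuple of behead t])) => [[a s] _|t _].
  by congr (_, _); apply: val_inj.
by rewrite /= -tuple_eta.
Qed.

Lemma big_tuple0 (T : finType) (V : nmodType) (G : seq T -> V) :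
  \sum_(t : 0.-tuple T) G t = G [::].
Proof.
by rewrite (big_pred1 [tuple]) // => t; rewrite (tuple0 t) /= eqxx.
Qed.

Lemma prod_sum_zip (T T' : finType) (V : comPzRingType) (W : T -> T' -> V) t :
  \sum_(l : (size t).-tuple T') \prod_(x <- zip t l) W x.1 x.2
  = \prod_(i <- t) \sum_j W i j.
Proof.
elim: t => [|i t IHt] /=.
  by rewrite (big_tuple0 (fun l : seq T' => \prod_(x <- zip [::] l) W x.1 x.2)) !big_nil.
rewrite (big_tuple_cons _ (fun l : seq T' => \prod_(x <- zip (i :: t) l) W x.1 x.2)).
rewrite big_cons -IHt mulr_suml; apply: eq_bigr => j _.
by rewrite mulr_sumr; apply: eq_bigr => l _; rewrite big_cons.
Qed.

(** * Linear substitutions in polynomials *)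

Section Lsubst.
Variables (K : fieldType) (n : nat).
Implicit Types (A B : 'M[K]_n) (f g : {mpoly K[n]}).

Lemma lsubstX A i : lsubst A 'X_i = linform (row i A).
Proof. by rewrite /lsubst comp_mpolyXU -tnth_nth tnth_mktuple. Qed.

Lemma lsubst_linform A l : lsubst A (linform l) = linform (l *m A).
Proof.
rewrite /linform /lsubst raddf_sum /=.
under eq_bigr => j _ do rewrite comp_mpolyZ -/(lsubst A _) lsubstX scaler_sumr.
rewrite exchange_big /=; apply: eq_bigr => j _.
rewrite mxE scaler_suml; apply: eq_bigr => i _.
by rewrite scalerA mxE.
Qed.

(** Both sides are f(B(Ax)), whence the reversed order of the factors. *)
Lemma lsubstM A B f : lsubst A (lsubst B f) = lsubst (B *m A) f.
Proof.
rewrite /lsubst !(comp_mpolyE f) raddf_sum /=; apply: eq_bigr => m _.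
rewrite comp_mpolyZ; congr (_ *: _).
rewrite rmorph_prod /=; apply: eq_bigr => i _.
rewrite rmorphXn /= !tnth_mktuple -/(lsubst A _) lsubst_linform.
by rewrite row_mul.
Qed.

Lemma lsubst1 f : lsubst 1%:M f = f.
Proof.
rewrite -[RHS]comp_mpoly_id; congr (_ \mPo _); apply: eq_mktuple => i.
rewrite /linform (bigD1 i) //= big1 ?addr0 => [|j ji].
  by rewrite !mxE eqxx scale1r.
by rewrite !mxE eq_sym (negPf ji) scale0r.
Qed.

Lemma linform_homog (l : 'rV[K]_n) : linform l \is 1.-homog.
Proof.
by apply: rpred_sum => i _; apply: rpredZ; rewrite dhomogX; apply/eqP/mdeg1.
Qed.

Lemma msize_dhomog d f : f \is d.-homog -> (msize f <= d.+1)%N.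
Proof.
move=> /dhomogP hf; rewrite msizeE; apply/bigmax_leqP_seq => m /hf md _.
by rewrite ltnS -md.
Qed.

End Lsubst.

(** * Slices and Hessians of list-indexed tensors *)

Section ListTensor.
Variables (K : fieldType) (n : nat).
Implicit Types (L : seq 'I_n -> K) (d e : nat).

(** Tensors are functions on lists, so that fixing an index is a cons; symmetry concerns lists of
    length [d] only. *)
Definition sym_on d L :=
  forall l l', size l = d -> perm_eq l l' -> L l = L l'.

Definition tens_poly d L : {mpoly K[n]} :=
  \sum_(t : d.-tuple 'I_n) L t *: \prod_(i <- t) 'X_i.

(** The two free indices come first, not last as in [slice]; symmetry reconciles the two in
    [bar_slice_tens]. *)
Definition lslice L (s : seq 'I_n) : 'M[K]_n := \matrix_(a, b) L (a :: b :: s).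

(* Up to the factor (e + 2)(e + 1), the Hessian of [tens_poly e.+2 L]. *)
Definition lhess e L (u : 'I_n -> K) : 'M[K]_n :=
  \sum_(s : e.-tuple 'I_n) (\prod_(i <- s) u i) *: lslice L s.

(** The tensor of f(Ax): every index of [L] is contracted with [A]. *)
Definition lsub d (A : 'M[K]_n) L (l : seq 'I_n) : K :=
  \sum_(t : d.-tuple 'I_n) L t * \prod_(x <- zip t l) A x.1 x.2.

Lemma tens_poly_homog d L : tens_poly d L \is d.-homog.
Proof.
apply: rpred_sum => t _; apply: rpredZ; rewrite mprodXE dhomogX.
rewrite /= mdeg_sum; under eq_bigr do rewrite mdeg1.
by rewrite sum1_size size_tuple.
Qed.

Lemma tens_poly_eval d L u :
  (tens_poly d L).@[u] = \sum_(t : d.-tuple 'I_n) L t * \prod_(i <- t) u i.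
Proof.
rewrite raddf_sum /=; apply: eq_bigr => t _; rewrite mevalZ rmorph_prod /=.
by under eq_bigr do rewrite mevalXU.
Qed.

Lemma symmetric_tensor_tens d L : sym_on d L ->
  symmetric_tensor_of (tens_poly d L)
    [ffun t : {ffun 'I_d -> 'I_n} => L [tuple t p | p < d]].
Proof.
move=> symL; split=> [s t|].
  rewrite !ffunE; apply: symL; first by rewrite size_tuple.
  rewrite perm_sym; apply/tuple_permP; exists (s^-1)%g; congr val; apply: eq_mktuple.
  by move=> p; rewrite tnth_mktuple ffunE permKV.
rewrite /tens_poly.
rewrite (reindex (fun t : {ffun 'I_d -> 'I_n} => [tuple t p | p < d])) /=.
  apply: eq_bigr => t _; rewrite ffunE; congr (_ *: _).
  by rewrite big_map big_enum.
exists (fun t : d.-tuple 'I_n => [ffun p => tnth t p]) => t _.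
  by apply/ffunP => p; rewrite ffunE tnth_mktuple.
by apply: eq_from_tnth => p; rewrite tnth_mktuple ffunE.
Qed.

Hypothesis K0 : [pchar K] =i pred0.

Lemma sym_tensor_tens d L : sym_on d L ->
  sym_tensor d (tens_poly d L)
  = [ffun t : {ffun 'I_d -> 'I_n} => L [tuple t p | p < d]].
Proof.
move=> /symmetric_tensor_tens symL; apply: sym_tensor_uniq K0 _ symL.
exact: (sym_tensorP K0 (tens_poly_homog d L)).
Qed.

(** This is the uniqueness of the symmetric tensor, read on lists. *)
Lemma tens_poly_inj d L L' : sym_on d L -> sym_on d L' ->
  tens_poly d L = tens_poly d L' -> forall l, size l = d -> L l = L' l.
Proof.
move=> symL symL' LL' l /eqP ld.
have := sym_tensor_tens symL; rewrite LL' (sym_tensor_tens symL').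
move=> /ffunP/(_ [ffun p => tnth (Tuple ld) p]); rewrite !ffunE.
suff -> : [tuple [ffun p => tnth (Tuple ld) p] p | p < d] = Tuple ld by [].
by apply: eq_from_tnth => p; rewrite tnth_mktuple ffunE.
Qed.

Lemma tens_poly_surj d f : f \is d.-homog ->
  exists2 L, sym_on d L & f = tens_poly d L.
Proof.
move=> hf; have [symT fT] := sym_tensorP K0 hf.
set T := sym_tensor d f in symT fT.
pose L l := if insub l is Some t then T [ffun p => tnth (t : d.-tuple 'I_n) p]
            else 0.
exists L.
  move=> l l' ld ll'; have l'd : size l' = d by rewrite -(perm_size ll').
  rewrite /L; move/eqP: ld => ld; move/eqP: l'd => l'd.
  rewrite !insubT /=.
  have /tuple_permP[s sl] : perm_eq (Tuple ld) (Tuple l'd) by [].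
  rewrite -(symT s [ffun p => tnth (Tuple l'd) p]); congr (T _).
  apply/ffunP => p; rewrite !ffunE.
  transitivity (tnth [tuple tnth (Tuple l'd) (s i) | i < d] p).
    by congr tnth; apply: val_inj.
  by rewrite tnth_mktuple.
rewrite fT /tens_poly.
rewrite [RHS](reindex (fun t : {ffun 'I_d -> 'I_n} => [tuple t p | p < d])).
  apply: eq_bigr => t _; rewrite /L valK big_map big_enum; congr (T _ *: _).
  by apply/ffunP => p; rewrite ffunE tnth_mktuple.
exists (fun t : d.-tuple 'I_n => [ffun p => tnth t p]) => t _.
  by apply/ffunP => p; rewrite ffunE tnth_mktuple.
by apply: eq_from_tnth => p; rewrite tnth_mktuple ffunE.
Qed.

Lemma bar_slice_tens e L k : sym_on e.+2 L ->
  bar_slice e.+2 (tens_poly e.+2 L) k = lslice L (nseq e k).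
Proof.
move=> symL; apply/matrixP => i j; rewrite !mxE sym_tensor_tens // ffunE.
apply: symL; first exact: size_tuple.
have -> : val [tuple [ffun p : 'I_e.+2 =>
    nth i ([tuple of nseq (e.+2 - 2) k] ++ [:: i; j]) p] p | p < e.+2]
    = nseq e k ++ [:: i; j].
  have szt (u : e.+2.-tuple 'I_n) : size u = e.+2 by apply: size_tuple.
  apply: (@eq_from_nth _ i) => [|p]; rewrite szt.
    by rewrite size_cat size_nseq /= addn2.
  move=> ltp; rewrite -[p]/(val (Ordinal ltp)) -tnth_nth tnth_mktuple ffunE /=.
  by rewrite subSS subSS subn0.
by rewrite perm_catC.
Qed.

Lemma lsubst_tens d L A : lsubst A (tens_poly d L) = tens_poly d (lsub d A L).
Proof.
rewrite /tens_poly /lsubst raddf_sum /=.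
under [RHS]eq_bigr => l _ do rewrite scaler_suml.
rewrite exchange_big /=; apply: eq_bigr => t _.
rewrite comp_mpolyZ rmorph_prod /=.
under eq_bigr => i _ do rewrite -/(lsubst A _) lsubstX /linform.
rewrite -(prod_sum_zip (fun i j => row i A 0 j *: 'X_j)) size_tuple scaler_sumr.
apply: eq_bigr => l _; rewrite -scalerA; congr (_ *: _).
have : size t = size l by rewrite !size_tuple.
elim: (val t) (val l) => [|a t' IH] [|b l'] //=.
  by rewrite !big_nil scale1r.
move=> [/IH {}IH]; rewrite !big_cons IH mxE.
by rewrite -scalerAl -scalerAr scalerA.
Qed.

(** A permutation of [l] is compensated by the same permutation of the summation tuple, under which
    [L] is invariant. *)
Lemma lsub_sym d L A : sym_on d L -> sym_on d (lsub d A L).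
Proof.
move=> symL l l' /eqP ld ll'; have l'd : size l' == d by rewrite -(perm_size ll').
have /tuple_permP[s sl] : perm_eq (Tuple ld) (Tuple l'd) by [].
have zipE (t u : d.-tuple 'I_n) :
    \prod_(x <- zip t u) A x.1 x.2 = \prod_(p < d) A (tnth t p) (tnth u p).
  rewrite -[zip t u]/(val [tuple of zip t u]) big_tuple; apply: eq_bigr => p _.
  pose i0 := tnth t p; rewrite (tnth_nth (i0, i0)) /= nth_zip ?size_tuple //=.
  by rewrite -!tnth_nth.
rewrite /lsub.
pose sh (t : d.-tuple 'I_n) := [tuple tnth t (s i) | i < d].
have shI : injective sh.
  move=> t t' tt'; apply: eq_from_tnth => p.
  by have := congr1 (fun u => tnth u ((s^-1)%g p)) tt'; rewrite !tnth_mktuple permKV.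
rewrite [LHS](reindex_inj shI); apply: eq_bigr => t _; congr (_ * _).
  apply: symL; first exact: size_tuple.
  by apply/tuple_permP; exists s.
rewrite -[l]/(val (Tuple ld)) -[l']/(val (Tuple l'd)) !zipE.
rewrite (val_inj sl : Tuple ld = [tuple tnth (Tuple l'd) (s i) | i < d]).
rewrite [RHS](reindex_inj (@perm_inj _ s)); apply: eq_bigr => p _.
by rewrite !tnth_mktuple.
Qed.

Lemma lslice_sub e L A s : size s = e ->
  lslice (lsub e.+2 A L) s
  = \sum_(t : e.-tuple 'I_n)
      (\prod_(x <- zip t s) A x.1 x.2) *: (A^T *m lslice L t *m A).
Proof.
move=> <-; apply/matrixP => i j; rewrite mxE /lsub.
rewrite (big_tuple_cons _ (fun t => L t * \prod_(x <- zip t (i :: j :: s)) A x.1 x.2)).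
under eq_bigr => a _.
  rewrite (big_tuple_cons _ (fun t =>
    L (a :: t) * \prod_(x <- zip (a :: t) (i :: j :: s)) A x.1 x.2)) /=.
  rewrite exchange_big /=.
  over.
rewrite exchange_big summxE /=; apply: eq_bigr => t _.
rewrite !mxE mulr_sumr exchange_big; apply: eq_bigr => b _ /=.
rewrite mxE mulr_suml mulr_sumr; apply: eq_bigr => a _.
by rewrite !big_cons /= !mxE; ring.
Qed.

(** The chain rule for the Hessian of f(Ax). *)
Lemma lhess_sub e L A u :
  lhess e (lsub e.+2 A L) u
  = A^T *m lhess e L (fun i => \sum_j A i j * u j) *m A.
Proof.
rewrite /lhess.
under eq_bigr => s _ do rewrite lslice_sub ?size_tuple // scaler_sumr.
rewrite exchange_big mulmx_sumr mulmx_suml; apply: eq_bigr => t _.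
rewrite -scalemxAr -scalemxAl.
under eq_bigr => s _ do rewrite scalerA.
rewrite -scaler_suml; congr (_ *: _).
rewrite -(prod_sum_zip (fun i j => A i j * u j)) size_tuple.
apply: eq_bigr => s _; have : size t = size s by rewrite !size_tuple.
elim: (val t) (val s) => [|a t' IH] [|b l'] //=.
  by rewrite !big_nil mulr1.
by move=> [/IH {}IH]; rewrite !big_cons -IH /=; ring.
Qed.

(** Slice [k] is [lhess] at the [k]-th basis vector, which [A] maps to its column [k]. Apart from
    the congruence by [A], the slice thus involves one column only, which allows conditioning on the
    others. *)
Lemma bar_slice_lsubst e L A k : sym_on e.+2 L ->
  bar_slice e.+2 (lsubst A (tens_poly e.+2 L)) k
  = A^T *m lhess e L (fun i => A i k) *m A.
Proof.
move=> symL; rewrite lsubst_tens bar_slice_tens; last exact: lsub_sym.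
rewrite lslice_sub ?size_nseq // /lhess mulmx_sumr mulmx_suml.
apply: eq_bigr => t _; rewrite -scalemxAr -scalemxAl; congr (_ *: _).
rewrite -{2}(size_tuple t); elim: (val t) => [|a t' IH]; first by rewrite !big_nil.
by rewrite /= !big_cons IH.
Qed.

Lemma lslice_tr e L s : sym_on e.+2 L -> size s = e -> (lslice L s)^T = lslice L s.
Proof.
move=> symL se; apply/matrixP => a b; rewrite !mxE.
apply: symL; first by rewrite /= se.
by apply/seq.permP => P /=; rewrite addnCA.
Qed.

Lemma lhess_tr e L u : sym_on e.+2 L -> (lhess e L u)^T = lhess e L u.
Proof.
move=> symL; rewrite /lhess raddf_sum /=; apply: eq_bigr => s _.
by rewrite linearZ /= (lslice_tr symL) ?size_tuple.
Qed.

Lemma tens_poly_diag d L : (0 < d)%N ->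
  (forall l i j, size l = d -> i \in l -> j \in l -> i != j -> L l = 0) ->
  tens_poly d L = \sum_i L (nseq d i) *: 'X_i ^+ d.
Proof.
move=> d0 L0; rewrite /tens_poly.
rewrite (eq_bigr (fun t : d.-tuple 'I_n => \sum_i
    if t == nseq_tuple d i then L t *: \prod_(i <- t) 'X_i else 0)).
  rewrite exchange_big /=; apply: eq_bigr => i _; rewrite -big_mkcond /=.
  by rewrite (big_pred1 (nseq_tuple d i)) //= big_nseq -Monoid.iteropE.
move=> t _; case: d d0 L0 t => // d _ L0 t.
rewrite [RHS](bigD1 (thead t)) //= [X in _ + X]big1 ?addr0 => [|i it]; last first.
  by case: ifP => // /eqP e; rewrite e /thead tnth_nseq eqxx in it.
case: ifPn => // /eqP tn; suff -> : L t = 0 by rewrite scale0r.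
have [/all_pred1P tE|/allPn[j jt jn]] := boolP (all (pred1 (thead t)) t).
  by case: tn; apply: val_inj; rewrite /= [LHS]tE size_tuple.
by apply: (L0 t j (thead t)); rewrite ?size_tuple // mem_tnth.
Qed.

End ListTensor.

(** * Simultaneous diagonalisation of the slices *)

Section Diagonalizable.
Variables (K : fieldType) (n : nat).
Implicit Types A B P Q : 'M[K]_n.

Lemma comm_mxZ c A B : comm_mx A B -> comm_mx A (c *: B).
Proof. by rewrite /comm_mx -scalemxAr -scalemxAl => ->. Qed.

Lemma codiagonalizable_family (I : finType) (A : I -> 'M[K]_n) :
  (forall i j, comm_mx (A i) (A j)) -> (forall i, diagonalizable (A i)) ->
  exists2 Q, Q \in unitmx & forall i, is_diag_mx (Q *m A i *m invmx Q).
Proof.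
move=> cA dA; have [|Q uQ /allP dQ] := (codiagonalizableP (codom A)).1.
  split=> [_ _ /codomP[i ->] /codomP[j ->] //|_ /codomP[i ->] //].
exists Q => // i; have := dQ _ (codom_f A i).
by move=> /(similar_diagP _ uQ) d; apply/is_diag_mxP => a b; apply: d.
Qed.

Lemma diagonalizable_sum (I : finType) (A : I -> 'M[K]_n) (c : I -> K) :
  (forall i j, comm_mx (A i) (A j)) -> (forall i, diagonalizable (A i)) ->
  diagonalizable (\sum_i c i *: A i).
Proof.
move=> cA dA; have [Q uQ dQ] := codiagonalizable_family cA dA.
exists Q => //; apply/(similar_diagP _ uQ) => a b ab.
rewrite mulmx_sumr mulmx_suml summxE big1 // => i _.
by rewrite -scalemxAr -scalemxAl mxE (is_diag_mxP (dQ i)) ?mulr0.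
Qed.

(** The algorithm writes the matrix as P D P^-1, while [diagonalizable] conjugates the other way, so
    its witness is [invmx P]. *)
Lemma diagonalizable_conj P A D : P \in unitmx -> is_diag_mx D ->
  A = P *m D *m invmx P -> diagonalizable A.
Proof.
move=> uP /is_diag_mxP dD ->; exists (invmx P); first by rewrite unitmx_inv.
apply/similar_diagP => [|a b ab]; first by rewrite unitmx_inv.
by rewrite invmxK !mulmxA mulVmx // mul1mx mulmxKV // dD.
Qed.

Lemma unitmx_col_neq0 A j : A \in unitmx -> exists i, A i j != 0.
Proof.
move=> uA; apply/existsP; apply: contraT => /existsPn A0.
have := (matrixP _ _).2 (mulVmx uA) j j; rewrite !mxE eqxx big1 => [/eqP|i _].
  by rewrite eq_sym oner_eq0.
by rewrite (eqP (negbNE (A0 i))) mulr0.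
Qed.

End Diagonalizable.

(** * From commuting diagonalisable slices to sums of powers *)

Section Separation.
Variables (K : fieldType) (n : nat).
Hypothesis K0 : [pchar K] =i pred0.
Implicit Types (L : seq 'I_n -> K) (G H : 'M[K]_n).

(* If [G i j != 0], then the characters [D s i] and [D s j] coincide, and the
   symmetry of [L] in the first and third index makes rows i and j of [G]
   proportional unless these characters vanish.  This is where degree at least
   3 is used. *)
Lemma sym_diag_factor e L G (D : seq 'I_n -> 'I_n -> K) :
  sym_on e.+3 L -> G \in unitmx -> G^T = G ->
  (forall s a b, size s = e.+1 -> L (a :: b :: s) = G a b * D s b) ->
  (forall i, exists2 s, size s = e.+1 & D s i != 0) ->
  forall i j, i != j -> G i j = 0.
Proof.
move=> symL uG symG LGD D0 i j ij; apply: contraNeq ij => Gij.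
have GC a b : G a b = G b a by rewrite -[in LHS]symG mxE.
(* Exchange the first two indices: where [G a b] is nonzero, the characters at [a] and [b] agree. *)
have cm s a b : size s = e.+1 -> G a b * D s b = G a b * D s a.
  move=> se; rewrite -LGD // [in RHS]GC -LGD //; apply: symL; first by rewrite /= se.
  by apply/seq.permP => P /=; rewrite addnCA.
have sw s k l : size s = e ->
    G i l * D (k :: s) l = G k l * D (i :: s) l.
  move=> se; rewrite -!LGD /= ?se //; apply: symL; first by rewrite /= se.
  by apply/seq.permP => P /=; lia.
have Dij s : size s = e.+1 -> D s j = D s i.
  by move=> se; apply: (mulfI Gij); rewrite cm.
have Di s : size s = e -> i != j -> D (i :: s) i = 0.
  move=> se ij; have se1 k : size (k :: s) = e.+1 by rewrite /= se.
  have rows : D (j :: s) i *: row i G = D (i :: s) i *: row j G.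
    apply/rowP => l; rewrite !mxE mulrC -cm // sw // cm // Dij // mulrC //.
  (* Rows [i] and [j] of [G] are independent; multiplying by [invmx G] and reading entry [j]
     isolates the coefficient of row [j]. *)
  have := congr1 (fun v => (v *m invmx G) 0 j) rows.
  rewrite -!scalemxAl -!row_mul mulmxV // !mxE eqxx (negPf ij) mulr0 mulr1.
  by move=> ->.
apply: contraT => ij; have [s se] := D0 j; case: s se => // k s [se].
have : G i j * D (k :: s) j = 0.
  by rewrite sw // Dij /= ?se // Di // mulr0.
by move=> /eqP; rewrite mulf_eq0 (negPf Gij) => /= /eqP ->; rewrite eqxx.
Qed.

(** In a basis that diagonalises all [invmx H *m lslice L s], the tensor factors as [G a b * D s b].
    Then [sym_diag_factor] makes [G] diagonal, so only the entries with all indices equal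
    survive. *)
Lemma codiagonalizable_slices_equiv e L u (H := lhess e.+1 L u) :
  sym_on e.+3 L -> H \in unitmx ->
  (forall s t : e.+1.-tuple 'I_n,
     comm_mx (invmx H *m lslice L s) (invmx H *m lslice L t)) ->
  (forall s : e.+1.-tuple 'I_n, diagonalizable (invmx H *m lslice L s)) ->
  exists2 g, in_Pd e.+3 g & equivalent (tens_poly e.+3 L) g.
Proof.
move=> symL uH cA dA; have [Q uQ dQ] := codiagonalizable_family cA dA.
pose P := invmx Q; pose G := P^T *m H *m P; pose L' := lsub e.+3 P L.
have uP : P \in unitmx by rewrite unitmx_inv.
have uG : G \in unitmx by rewrite !unitmx_mul unitmx_tr uP uH.
have symG : G^T = G by rewrite !trmx_mul trmxK (lhess_tr _ symL) mulmxA.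
have symL' : sym_on e.+3 L' by apply: lsub_sym.
(* [D s i] is the [i]-th diagonal entry of [invmx G *m lslice L' s]. *)
pose D s i := \sum_(t : e.+1.-tuple 'I_n) (\prod_(x <- zip t s) P x.1 x.2) *
  (Q *m (invmx H *m lslice L t) *m P) i i.
have LGD s a b : size s = e.+1 -> L' (a :: b :: s) = G a b * D s b.
  move=> se; transitivity (lslice L' s a b); first by rewrite mxE.
  rewrite (lslice_sub L P se).
  rewrite summxE mulr_sumr; apply: eq_bigr => t _; rewrite mxE mulrCA.
  congr (_ * _); have -> : P^T *m lslice L t *m P
      = G *m (Q *m (invmx H *m lslice L t) *m P).
    by rewrite /G !mulmxA mulmxKV // mulmxK.
  rewrite mxE (bigD1 b) //= big1 ?addr0 // => c cb.
  by rewrite (is_diag_mxP (dQ t)) ?mulr0.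
(* [G] is the Hessian of the transformed form at [Q u], hence a combination of its slices. If all
   [D s i] vanished for some [i], column [i] of [G] would be zero. *)
have GE : lhess e.+1 L' (fun i => \sum_j Q i j * u j) = G.
  rewrite lhess_sub; congr (_ *m _ *m _); rewrite /H; congr (lhess _ _).
  apply/funext => i; have := (matrixP _ _).2 (mulVmx uQ) i.
  move=> PQ; under eq_bigr do rewrite mulr_sumr.
  rewrite exchange_big /= (bigD1 i) //= [X in _ + X]big1 ?addr0 => [|j ji].
    under eq_bigr do rewrite mulrA.
    by rewrite -mulr_suml; have := PQ i; rewrite !mxE eqxx => ->; rewrite mul1r.
  under eq_bigr do rewrite mulrA.
  rewrite -mulr_suml; have := PQ j; rewrite !mxE eq_sym (negPf ji) => ->.
  by rewrite mul0r.
have D0 i : exists2 s, size s = e.+1 & D s i != 0.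
  have [a Gai] := unitmx_col_neq0 i uG.
  suff [s Ds] : exists s : e.+1.-tuple 'I_n, D s i != 0.
    by exists s; rewrite ?size_tuple.
  apply/existsP; apply: contraR Gai => /existsPn Ds.
  rewrite -GE summxE big1 // => s _; rewrite !mxE LGD ?size_tuple //.
  by rewrite (eqP (negbNE (Ds s))) !mulr0.
have diagG := sym_diag_factor symL' uG symG LGD D0.
(* Two distinct indices can be moved to the front, where they produce the factor [G i j], which is
   zero. *)
have L'0 l i j : size l = e.+3 -> i \in l -> j \in l -> i != j -> L' l = 0.
  move=> le il jl ij; have jl' : j \in rem i l.
    by have := jl; rewrite (perm_mem (perm_to_rem il)) inE eq_sym (negPf ij).
  have pl : perm_eq l (i :: j :: rem j (rem i l)).
    rewrite (perm_trans (perm_to_rem il)) // perm_cons; exact: perm_to_rem.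
  rewrite (symL' _ _ le pl) LGD ?diagG ?mul0r //.
  by have := perm_size pl; rewrite le /= => -[].
exists (\sum_i L' (nseq e.+3 i) *: 'X_i ^+ e.+3).
  exists (fun i => L' (nseq e.+3 i)) => // i.
  have [s se Ds] := D0 i; have [a Gai] := unitmx_col_neq0 i uG.
  have Gii : G i i != 0.
    by case: (eqVneq a i) Gai => [->|ai] //; rewrite diagG ?eqxx.
  (* This nonzero entry must have all its indices equal to [i], so it is the coefficient in
     question. *)
  have L's : L' (i :: i :: s) != 0 by rewrite LGD // mulf_neq0.
  suff sE : s = nseq e.+1 i by move: L's; rewrite sE.
  rewrite -se; apply/all_pred1P.
  apply: contraT => /allPn[j js ji]; case/eqP: L's; apply: (L'0 _ i j).
  - by rewrite /= se.
  - by rewrite inE eqxx.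
  - by rewrite !inE js !orbT.
  - by rewrite eq_sym.
exists Q => //; rewrite -(tens_poly_diag _ L'0) // -lsubst_tens lsubstM.
by rewrite mulVmx // lsubst1.
Qed.

(** Applying [phi] to the slices gives a symmetric tensor [Y] of order [e], whose polynomial is the
    value of [phi] on the Hessian; it is nonzero by uniqueness of the symmetric tensor. Linear
    conditions on Hessians thereby become input for Schwartz-Zippel. *)
Lemma lslice_functional_poly e L (phi : 'M[K]_n -> K) s :
  sym_on e.+2 L -> scalar phi -> size s = e -> phi (lslice L s) != 0 ->
  exists p : {mpoly K[n]}, [/\ p != 0, (msize p <= e.+1)%N &
    forall u, p.@[u] = phi (lhess e L u)].
Proof.
move=> symL phiL se phis; pose Y s := phi (lslice L s).
have symY : sym_on e Y.
  move=> l l' le ll'; congr phi; apply/matrixP => a b; rewrite !mxE.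
  by apply: symL; rewrite /= ?le // !perm_cons.
have sym0 : sym_on e ((fun=> 0) : seq 'I_n -> K) by [].
exists (tens_poly e Y); split=> [||u].
- apply: contraNneq phis => Y0; apply/eqP.
  rewrite -/(Y s) (tens_poly_inj K0 symY sym0) //.
  by rewrite Y0 /tens_poly big1 // => t _; rewrite scale0r.
- exact/msize_dhomog/tens_poly_homog.
have phi0 : phi 0 = 0.
  by have := phiL (-1) 0 0; rewrite scaler0 addr0 mulN1r addNr.
rewrite tens_poly_eval /lhess; elim/big_rec2: _ => [|t x X _ ->] //.
by rewrite phiL mulrC.
Qed.

End Separation.

(** * Probability of rejection *)

Section Setcol.
Variables (T : Type) (n : nat).

Lemma setcol_same (k : 'I_n) (v : 'I_n -> T) M : (setcol k v M)^~ k = v.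
Proof. by apply/funext => i; rewrite mxE eqxx. Qed.

Lemma setcol_other (k j : 'I_n) (v : 'I_n -> T) M :
  j != k -> (setcol k v M)^~ j = M^~ j.
Proof. by move=> jk; apply/funext => i; rewrite mxE (negPf jk). Qed.

End Setcol.

(** Congruent slices give similar quotients, and similarity preserves commutation and
    diagonalisability. *)
Lemma invmx_congruence (K : fieldType) n (M H X : 'M[K]_n) :
  M \in unitmx -> H \in unitmx ->
  invmx (M^T *m H *m M) *m (M^T *m X *m M) = invmx M *m (invmx H *m X) *m M.
Proof.
move=> uM uH; have uMHM : M^T *m H *m M \in unitmx.
  by rewrite !unitmx_mul unitmx_tr uM uH.
apply: (can_inj (mulKmx uMHM)); rewrite mulKVmx //.
by rewrite !mulmxA mulmxK // mulmxK.
Qed.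

Lemma invmx_mulmx (K : fieldType) n (A B : 'M[K]_n) :
  A \in unitmx -> B \in unitmx -> invmx (A *m B) = invmx B *m invmx A.
Proof.
move=> uA uB; have uAB : A *m B \in unitmx by rewrite unitmx_mul uA.
apply: (can_inj (mulKmx uAB)); rewrite mulmxV //.
by rewrite mulmxA mulmxK // mulmxV.
Qed.

Section CommutationTest.
Variables (F : realFieldType) (K : fieldType) (S : {fset K}) (n : nat).
Hypotheses (K0 : [pchar K] =i pred0) (S0 : S != fset0) (hn : (3 <= n)%N).
Variables (e : nat) (L : seq 'I_n -> K).
Hypothesis symL : sym_on e.+2 L.

Let H (M : 'M[K]_n) := lhess e L (M^~ (k1 hn)).
Let A (M : 'M[K]_n) u := invmx (H M) *m lhess e L u.

(** Unless every run rejects, the tests on the slices can be passed; conjugation by [M] carries them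
    over to the Hessians at the columns of [M]. *)
Lemma reject_or_codiag M : rejects hn e.+2 (tens_poly e.+2 L) M \/
  [/\ H M \in unitmx, comm_mx (A M (M^~ (k2 hn))) (A M (M^~ (k3 hn))) &
      diagonalizable (A M (M^~ (k2 hn)))].
Proof.
have [?|nrej] := pselect (rejects hn e.+2 (tens_poly e.+2 L) M); first by left.
right; apply: contrapT => nA; apply: nrej => o; case=> //.
move=> P D /=; rewrite !bar_slice_lsubst //.
rewrite !unitmx_mul unitmx_tr => /andP[/andP[uM uH] _].
rewrite !invmx_congruence //.
move=> cA uP dD E; case: nA; split=> //.
  have := congr1 (fun X => M *m X *m invmx M) cA.
  by rewrite /= !mulmxA mulmxV // !mul1mx !mulmxK // /comm_mx /A !mulmxA.
apply: (@diagonalizable_conj _ _ (M *m P) _ D) => //.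
  by rewrite unitmx_mul uM.
rewrite invmx_mulmx // mulmxA -[M *m P *m D]mulmxA -[M *m (P *m D) *m _]mulmxA -E.
by rewrite !mulmxA mulmxV // mul1mx mulmxK.
Qed.

(** With the first two columns fixed, each entry of the commutator is a linear functional of the
    Hessian at the third column, and some entry is nonzero for the slice [s]. *)
Lemma prob_mx_commute_col3 :
  prob_mx F S (fun M =>
    (exists s : e.-tuple 'I_n,
       ~ comm_mx (A M (M^~ (k2 hn))) (invmx (H M) *m lslice L s)) /\
    comm_mx (A M (M^~ (k2 hn))) (A M (M^~ (k3 hn)))) <= e%:R / #|` S|%:R.
Proof.
apply: (prob_mx_col F S0 (k := k3 hn)) => M.
have [[s /eqP ncs]|cs] := pselect (exists s : e.-tuple 'I_n,
       ~ comm_mx (A M (M^~ (k2 hn))) (invmx (H M) *m lslice L s)); last first.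
  (* Here the event is impossible whatever the third column, so the constant polynomial 1 serves. *)
  exists 1; split=> [||v _]; rewrite ?oner_neq0 ?msize1 //.
  rewrite /A /H (@setcol_other _ _ (k3 hn) (k1 hn)) //.
  by rewrite (@setcol_other _ _ (k3 hn) (k2 hn)) // => -[].
set B := A M _ in ncs.
have [a [b ab]] : exists a b,
    (B *m (invmx (H M) *m lslice L s)) a b
     != (invmx (H M) *m lslice L s *m B) a b.
  have /matrix0Pn[a [b ab]] : B *m (invmx (H M) *m lslice L s)
     - invmx (H M) *m lslice L s *m B != 0 by rewrite subr_eq0.
  by exists a, b; move: ab; rewrite mxE [X in _ + X]mxE subr_eq0.
pose phi X := (B *m (invmx (H M) *m X)) a b - (invmx (H M) *m X *m B) a b.
have phiL : scalar phi.
  move=> c X Y; rewrite /phi !(mulmxDr, mulmxDl) -!(scalemxAr, scalemxAl).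
  have ZE (Z : 'M[K]_n) : (c *: Z) a b = c * Z a b by rewrite mxE.
  by rewrite [in LHS]mxE [in X in _ - X]mxE !ZE; ring.
have phis : phi (lslice L s) != 0 by rewrite subr_eq0.
have [p [p0 szp pE]] := lslice_functional_poly K0 symL phiL (size_tuple s) phis.
exists p; split=> // v _; rewrite pE /A /H setcol_same.
rewrite (@setcol_other _ _ (k3 hn) (k1 hn)) // (@setcol_other _ _ (k3 hn) (k2 hn)) //.
rewrite -/(H M) -/(A M _) -/B => -[_ cv].
by apply/eqP; rewrite subr_eq0; apply/eqP/(congr1 (fun X : 'M_n => X a b) cv).
Qed.

End CommutationTest.

Section RejectionProbability.
Variables (F : realFieldType) (K : fieldType) (S : {fset K}) (n : nat).
Hypotheses (K0 : [pchar K] =i pred0) (S0 : S != fset0) (hn : (3 <= n)%N).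
Variables (e : nat) (L : seq 'I_n -> K).
Hypothesis symL : sym_on e.+3 L.
Hypothesis nPd : forall g, in_Pd e.+3 g -> ~ equivalent (tens_poly e.+3 L) g.

Let H (M : 'M[K]_n) := lhess e.+1 L (M^~ (k1 hn)).
Let A (M : 'M[K]_n) u := invmx (H M) *m lhess e.+1 L u.

(* The matrices of this event span a space of commuting diagonalisable matrices,
   which by assumption does not contain all slices. *)
Lemma prob_mx_diagonalizable_col2 :
  prob_mx F S (fun M =>
    [/\ H M \in unitmx, diagonalizable (A M (M^~ (k2 hn))) &
    (forall s : e.+1.-tuple 'I_n,
       comm_mx (A M (M^~ (k2 hn))) (invmx (H M) *m lslice L s))])
  <= e.+1%:R / #|` S|%:R.
Proof.
apply: (prob_mx_col F S0 (k := k2 hn)) => M.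
pose E u := [/\ H M \in unitmx, diagonalizable (A M u) &
    (forall s : e.+1.-tuple 'I_n,
       comm_mx (A M u) (invmx (H M) *m lslice L s))].
(* [U] collects the columns over [S] that satisfy the event, and [W] spans the corresponding
   matrices. *)
pose U := [pred v : {ffun 'I_n -> S} | asbool (E (fun i => val (v i)))].
pose V (i : 'I_#|U|) : {ffun 'I_n -> S} := enum_val i.
pose B i := A M (fun j => val (V i j)).
have EB i : E (fun j => val (V i j)).
  have := enum_valP i; rewrite inE; exact.
pose W := \matrix_i mxvec (B i).
have spanW X : (mxvec X <= W)%MS -> exists c : 'I_#|U| -> K, X = \sum_i c i *: B i.
  case/submxP => c Xc; exists (c 0); apply: (can_inj mxvecK).
  rewrite Xc mulmx_sum_row linear_sum; apply: eq_bigr => i _.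
  by rewrite rowK linearZ.
have [uH|nuH] := boolP (H M \in unitmx); last first.
  exists 1; split=> [||v _]; rewrite ?oner_neq0 ?msize1 //.
  by rewrite /A /H !(@setcol_other _ _ (k2 hn) (k1 hn)) // -/(H M) (negPf nuH) => -[].
(* Otherwise all slices would be combinations of the [B i], hence commuting and diagonalisable,
   which would make the form equivalent to a sum of powers. *)
have [s sW] : exists s : e.+1.-tuple 'I_n,
    ~~ (mxvec (invmx (H M) *m lslice L s) <= W)%MS.
  apply/existsP; apply: contraT => /existsPn sW.
  have {}sW (s : e.+1.-tuple 'I_n) :
      (mxvec (invmx (H M) *m lslice L s) <= W)%MS.
    by have := sW s; rewrite negbK.
  have cA (s t : e.+1.-tuple 'I_n) :
      comm_mx (invmx (H M) *m lslice L s) (invmx (H M) *m lslice L t).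
    have [c ->] := spanW _ (sW s); apply: comm_mx_sym.
    apply: comm_mx_sum => i _; apply: comm_mxZ; apply: comm_mx_sym.
    by have [_ _] := EB i; apply.
  have cB i j : comm_mx (B i) (B j).
    rewrite {2}/B /A /lhess mulmx_sumr; apply: comm_mx_sum => s _.
    by rewrite -scalemxAr; apply: comm_mxZ; have [_ _] := EB i; apply.
  have [g gP fg] : exists2 g, in_Pd e.+3 g & equivalent (tens_poly e.+3 L) g.
    apply: (codiagonalizable_slices_equiv symL uH cA) => s.
    have [c ->] := spanW _ (sW s); apply: diagonalizable_sum => // i.
    by have [_ ] := EB i.
  by case: (nPd gP fg).
(* A column of [cokermx W] is a functional that vanishes on [W] but not on this slice. *)
have [j jW] : exists j,
    (mxvec (invmx (H M) *m lslice L s) *m cokermx W) 0 j != 0.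
  by move: sW; rewrite submxE => /rV0Pn.
pose phi X := (mxvec (invmx (H M) *m X) *m cokermx W) 0 j.
have phiL : scalar phi.
  move=> c X Y; rewrite /phi mulmxDr linearD /= mulmxDl -scalemxAr linearZ /=.
  by rewrite -scalemxAl !mxE.
have [p [p0 szp pE]] := lslice_functional_poly K0 symL phiL (size_tuple s) jW.
exists p; split=> // v vS; rewrite pE /A /H setcol_same.
rewrite (@setcol_other _ _ (k2 hn) (k1 hn)) // -/(H M) -/(A M v) => Ev.
pose w : {ffun 'I_n -> S} := [ffun i => [` vS i]%fset].
have wE : (fun i => val (w i)) = v by apply/funext => i; rewrite ffunE.
have wU : w \in U by rewrite inE wE; exact: Ev.
suff : (mxvec (A M v) <= W)%MS by rewrite submxE /phi => /eqP ->; rewrite mxE.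
have -> : mxvec (A M v) = row (enum_rank_in wU w) W.
  by rewrite rowK /B /V enum_rankK_in // wE.
exact: row_sub.
Qed.

Lemma prob_mx_rejects :
  1 - (2 * e.+1)%:R / #|` S|%:R
  <= prob_mx F S (rejects hn e.+3 (tens_poly e.+3 L)).
Proof.
pose E3 M := (exists s : e.+1.-tuple 'I_n,
       ~ comm_mx (A M (M^~ (k2 hn))) (invmx (H M) *m lslice L s)) /\
    comm_mx (A M (M^~ (k2 hn))) (A M (M^~ (k3 hn))).
pose E2 M := [/\ H M \in unitmx, diagonalizable (A M (M^~ (k2 hn))) &
    (forall s : e.+1.-tuple 'I_n,
       comm_mx (A M (M^~ (k2 hn))) (invmx (H M) *m lslice L s))].
apply: (@le_trans _ _ (1 - prob_mx F S (fun M => E3 M \/ E2 M))); last first.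
  apply: prob_mx_ge => // M.
  have [?|[uH cA dA]] := reject_or_codiag K0 hn symL M; first by left.
  (* A slice that fails to commute leads to [E3], and the absence of such a slice to [E2]. *)
  have [[s ns]|ns] := pselect (exists s : e.+1.-tuple 'I_n,
    ~ comm_mx (A M (M^~ (k2 hn))) (invmx (H M) *m lslice L s)).
    by right; left; split; [exists s|exact: cA].
  right; right; split; [exact: uH|exact: dA|] => s.
  by apply: contrapT => cs; apply: ns; exists s.
rewrite lerB // mulSn mul1n natrD mulrDl.
apply: (le_trans (prob_mxU _ _ _ _)); apply: lerD; last exact: prob_mx_diagonalizable_col2.
exact: prob_mx_commute_col3.
Qed.

End RejectionProbability.

(** * Probability of a correct output *)

Section DiagonalForm.
Variables (K : fieldType) (n : nat) (a : 'I_n -> K).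

Definition diag_form d : {mpoly K[n]} := \sum_(i < n) a i *: 'X_i ^+ d.

(** One tensor for all positive degrees: [a i] on nonempty lists constantly equal to [i], zero on
    nonconstant lists. *)
Definition diag_tens (l : seq 'I_n) : K := \sum_i a i *+ all (pred1 i) l.

Lemma diag_tens_sym d : sym_on d diag_tens.
Proof. by move=> l l' _ ll'; apply: eq_bigr => i _; rewrite (perm_all _ ll'). Qed.

Lemma diag_tensE i l : diag_tens (i :: l) = a i *+ all (pred1 i) l.
Proof.
rewrite /diag_tens (bigD1 i) //= eqxx big1 ?addr0 // => j /negPf ji.
by rewrite eq_sym ji.
Qed.

Lemma tens_poly_diag_tens d : tens_poly d.+1 diag_tens = diag_form d.+1.
Proof.
rewrite tens_poly_diag //.
  by apply: eq_bigr => i _; rewrite diag_tensE all_nseq /= eqxx orbT.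
move=> l i j _ il jl ij; rewrite /diag_tens big1 // => k _.
case: allP => // lk; case/eqP: ij.
by rewrite (eqP (lk _ il)) (eqP (lk _ jl)).
Qed.

Lemma lhess_diag_tens e u :
  lhess e diag_tens u = diag_mx (\row_i (a i * u i ^+ e)).
Proof.
apply/matrixP => p q; rewrite summxE !mxE.
rewrite (bigD1 (nseq_tuple e p)) //= [X in _ + X]big1 ?addr0 => [|s sp].
  rewrite !mxE diag_tensE /= all_nseq /= eqxx orbT andbT big_nseq -Monoid.iteropE.
  by rewrite -[iterop _ _ _ _]/(u p ^+ e) mulrnAr mulrC [q == p]eq_sym.
rewrite !mxE diag_tensE /=; case: (boolP (all _ s)) => [/all_pred1P sE|_].
  by case/eqP: sp; apply: val_inj; rewrite /= sE size_tuple.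
by rewrite andbF mulr0.
Qed.

Lemma lsubst_diag_form d A :
  lsubst A (diag_form d) = \sum_i a i *: linform (row i A) ^+ d.
Proof.
rewrite /lsubst raddf_sum /=; apply: eq_bigr => i _.
by rewrite comp_mpolyZ rmorphXn /= -/(lsubst A _) lsubstX.
Qed.

End DiagonalForm.

(** * Invertibility of a random matrix *)

Section Determinant.
Variables (F : realFieldType) (K : fieldType) (S : {fset K}) (n : nat).
Hypothesis S0 : S != fset0.

Lemma linform_eval (l : 'rV[K]_n) v : (linform l).@[v] = \sum_j l 0 j * v j.
Proof.
rewrite raddf_sum /=; apply: eq_bigr => j _.
by rewrite mevalZ mevalXU.
Qed.

Lemma meval_neq0 (p : {mpoly K[n]}) v : p.@[v] != 0 -> p != 0.
Proof. by apply: contraNneq => ->; rewrite meval0. Qed.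

Lemma det_setcol (M : 'M[K]_n) j v :
  \det (setcol j v M) = \sum_i v i * cofactor M i j.
Proof.
rewrite (expand_det_col _ j); apply: eq_bigr => i _; rewrite mxE eqxx.
congr (_ * (_ * \det _)); apply/matrixP => a b; rewrite !mxE.
by rewrite eq_sym (negPf (neq_lift _ _)).
Qed.

(* The columns of the identity are replaced one at a time by those of a random
   matrix; the determinant is linear in each new column. *)
Lemma prob_mx_singular :
  prob_mx F S (fun M : 'M[K]_n => M \notin unitmx) <= n%:R / #|` S|%:R.
Proof.
pose hyb k (M : 'M[K]_n) := \matrix_(i, j) if (j < k)%N then M i j else (i == j)%:R.
pose E (j : 'I_n) (M : 'M[K]_n) := \det (hyb j M) != 0 /\ \det (hyb j.+1 M) = 0.
apply: (@le_trans _ _ (\sum_(j < n | xpredT j) prob_mx F S (E j))).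
  apply: le_trans (prob_mx_bigU _ _ _ _); apply: prob_mx_le => M.
  rewrite unitmxE unitfE negbK => /eqP dM.
  suff [j [jn Ej]] : exists j, (j < n)%N /\
      (\det (hyb j M) != 0 /\ \det (hyb j.+1 M) = 0) by exists (Ordinal jn).
  have d0 : \det (hyb 0%N M) != 0.
    have -> : hyb 0%N M = 1%:M by apply/matrixP => i j; rewrite !mxE.
    by rewrite det1 oner_neq0.
  have dn : \det (hyb n M) == 0.
    have -> : hyb n M = M by apply/matrixP => i j; rewrite !mxE ltn_ord.
    by rewrite dM.
  have ex : exists k, \det (hyb k M) == 0 by exists n.
  (* The first singular hybrid is not the identity, so it has a predecessor, which is
     nonsingular. *)
  case: (ex_minnP ex) => -[|k] dk kmin; first by rewrite dk in d0.
  exists k; split; first exact: kmin.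
  split; last exact/eqP.
  by apply/negP => /kmin; rewrite ltnn.
apply: (@le_trans _ _ (\sum_(j < n) 1%:R / #|` S|%:R)); last first.
  by rewrite sumr_const card_ord mul1r mulr_natl.
apply: ler_sum => j _; apply: (prob_mx_col F S0 (k := j)) => M.
have hyb_j v : hyb j (setcol j v M) = hyb j M.
  apply/matrixP => a b; rewrite !mxE; case: ifP => // bj.
  by case: eqP => // eb; rewrite eb ltnn in bj.
have hyb_j1 v : hyb j.+1 (setcol j v M) = setcol j v (hyb j M).
  apply/matrixP => a b; rewrite !mxE ltnS leq_eqVlt.
  by case: (eqVneq b j) => [->|bj]; rewrite ?eqxx // -[_ == _ :> nat]/(b == j) (negPf bj).
have [d0|d0] := eqVneq (\det (hyb j M)) 0.
  exists 1; split=> [||v _]; rewrite ?oner_neq0 ?msize1 //.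
  by rewrite /E hyb_j d0 eqxx => -[].
pose p := linform (\row_i cofactor (hyb j M) i j).
have pE v : p.@[v] = \det (setcol j v (hyb j M)).
  by rewrite linform_eval det_setcol; apply: eq_bigr => i _; rewrite mxE mulrC.
exists p; split.
(* Putting back the old column [j] recovers [hyb j M], so the linear form is nonzero. *)
- apply: (@meval_neq0 _ ((hyb j M)^~ j)); rewrite pE.
  suff -> : setcol j ((hyb j M)^~ j) (hyb j M) = hyb j M by [].
  by apply/matrixP => a b; rewrite mxE; case: eqP => // ->.
- exact/msize_dhomog/linform_homog.
by move=> v _ [_]; rewrite hyb_j1 pE.
Qed.

End Determinant.

Lemma card_ord_pairs n : #|[pred p : 'I_n * 'I_n | (p.1 < p.2)%N]| = 'C(n, 2).
Proof.
rewrite -sum1_card -bin2_sum big_mkord.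
rewrite -(pair_big_dep predT (fun i j : 'I_n => (i < j)%N) (fun _ _ => 1%N)) /=.
rewrite (exchange_big_dep predT) //=; apply: eq_bigr => j _.
rewrite -(big_ord_widen n (fun=> 1%N)) ?(ltnW (ltn_ord j)) //.
by rewrite sum1_card card_ord.
Qed.

Section Acceptance.
Variables (F : realFieldType) (K : fieldType) (S : {fset K}) (n : nat).
Hypotheses (K0 : [pchar K] =i pred0) (S0 : S != fset0) (hn : (3 <= n)%N).
Variables (e : nat) (a : 'I_n -> K) (A : 'M[K]_n).
Hypotheses (a0 : forall i, a i != 0) (uA : A \in unitmx).

Let f := lsubst A (diag_form a e.+3).

(** In the coordinates given by [C], the matrix to be diagonalised is diagonal with distinct entries
    [lam (k2 hn)]. Hence, whichever diagonalisation is chosen, [C *m P] has exactly one nonzero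
    entry in each row and column, and f(RPx) is a sum of powers of variables. The last hypothesis is
    the distinctness of these eigenvalues with denominators cleared. *)
Lemma good_outputs_decomposition (R : 'M[K]_n) (C := A *m R) :
  R \in unitmx -> (forall i, C i (k1 hn) != 0) ->
  (forall i j, i != j -> (C i (k2 hn) * C j (k1 hn)) ^+ e.+1
                      != (C j (k2 hn) * C i (k1 hn)) ^+ e.+1) ->
  outputs_decomposition hn e.+3 f R.
Proof.
have CE : C = A *m R by [].
clearbody C => uR C1 C2.
have uC : C \in unitmx by rewrite CE unitmx_mul uA.
pose lam k := \row_i ((C i k) ^+ e.+1 / (C i (k1 hn)) ^+ e.+1).
have sliceE k : bar_slice e.+3 (lsubst R f) k
    = C^T *m diag_mx (\row_i (a i * C i k ^+ e.+1)) *m C.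
  rewrite /f lsubstM -CE -tens_poly_diag_tens bar_slice_lsubst ?lhess_diag_tens //.
  exact: diag_tens_sym.
have uD : diag_mx (\row_i (a i * C i (k1 hn) ^+ e.+1)) \in unitmx.
  rewrite unitmxE unitfE det_diag prodf_seq_neq0; apply/allP => i _ /=.
  by rewrite mxE mulf_neq0 ?expf_neq0 ?a0 ?C1.
have uT : bar_slice e.+3 (lsubst R f) (k1 hn) \in unitmx.
  by rewrite sliceE !unitmx_mul unitmx_tr uC uD.
have TE k : invmx (bar_slice e.+3 (lsubst R f) (k1 hn)) *m
    bar_slice e.+3 (lsubst R f) k = invmx C *m diag_mx (lam k) *m C.
  rewrite !sliceE invmx_congruence //; congr (_ *m _ *m _).
  rewrite -[RHS](mulKmx uD); congr (_ *m _); rewrite mulmx_diag; congr diag_mx.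
  apply/rowP => i; rewrite !mxE; field.
  by rewrite expf_neq0.
have lam2 i j : i != j -> lam (k2 hn) 0 i != lam (k2 hn) 0 j.
  move=> ij; rewrite !mxE eqr_div ?expf_neq0 // -!exprMn; exact: C2.
move=> o; case => [|h T1' T2 T3 _|P D h T1' T2 T3 _ _ uP dD].
- by rewrite uT.
- rewrite /T1' /T2 /T3 !TE => -[]; case.
    have conjM (X Y : 'M[K]_n) : (invmx C *m X *m C) *m (invmx C *m Y *m C)
        = invmx C *m (X *m Y) *m C by rewrite !mulmxA mulmxK.
    by rewrite /comm_mx !conjM diag_mxC.
  apply: (@diagonalizable_conj _ _ (invmx C) _ (diag_mx (lam (k2 hn)))).
  + by rewrite unitmx_inv.
  + exact: diag_mx_is_diag.
  + by rewrite invmxK.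
rewrite /T1' /T2 TE => PD; eexists; first by [].
have [Q QCP] : exists Q, Q = C *m P by exists (C *m P).
have uQ : Q \in unitmx by rewrite QCP unitmx_mul uC.
have QE i j : Q i j * D j j = lam (k2 hn) 0 i * Q i j.
  have : diag_mx (lam (k2 hn)) *m Q = Q *m D.
    rewrite QCP -!mulmxA; apply: (can_inj (mulKmx (_ : invmx C \in unitmx))).
      by rewrite unitmx_inv.
    rewrite mulKmx // !mulmxA PD mulmxKV //.
  move=> /matrixP/(_ i j); rewrite mul_diag_mx [LHS]mxE => ->; rewrite mxE.
  rewrite (bigD1 j) //= big1 ?addr0 // => k kj.
  by rewrite (is_diag_mxP dD) ?mulr0.
(* The columns of [Q] are eigenvectors of a diagonal matrix with distinct eigenvalues. *)
have colQ i i' j : Q i j != 0 -> Q i' j != 0 -> i = i'.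
  have DE k : Q k j != 0 -> lam (k2 hn) 0 k = D j j.
    by move=> Qk; apply: (mulIf Qk); rewrite -QE mulrC.
  move=> Qi Qi'; have [//|/lam2] := eqVneq i i'.
  by rewrite !DE // eqxx.
(* Two columns supported on the same row would be proportional, against the invertibility of [Q]. *)
have rowQ i j j' : Q i j != 0 -> Q i j' != 0 -> j = j'.
  move=> Qj Qj'; apply/eqP; apply: contraNT (Qj') => jj'.
  have cols : Q i j' *: col j Q = Q i j *: col j' Q.
    apply/colP => k; rewrite !mxE; have [->|ki] := eqVneq k i.
      exact: mulrC.
    have Q0 m : Q i m != 0 -> Q k m = 0.
      by move=> Qm; apply: contraNeq ki => Qk; rewrite (colQ _ _ _ Qk Qm).
    by rewrite !Q0 // !mulr0.
  have := congr1 (fun v => (invmx Q *m v) j 0) cols.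
  rewrite -!scalemxAr !colE !mulKmx // !mxE eqxx (negPf jj') /= mulr0 mulr1.
  by move=> ->.
have lsubstQ : lsubst (R *m P) f = \sum_i a i *: linform (row i Q) ^+ e.+3.
  by rewrite /f lsubstM mulmxA -CE -QCP lsubst_diag_form.
have alE j : (lsubst (R *m P) f).@[fun k => (k == j)%:R]
    = \sum_i a i * Q i j ^+ e.+3.
  rewrite lsubstQ raddf_sum /=; apply: eq_bigr => i _.
  rewrite mevalZ rmorphXn /= linform_eval (bigD1 j) //= eqxx mulr1 mxE.
  rewrite [X in _ + X]big1 ?addr0 // => k /negPf ->.
  by rewrite mulr0.
(* Each [row i Q] is a multiple of one variable, so the coefficients can be read off at the basis
   vectors. *)
have fQ : lsubst (R *m P) f = diag_form
    (fun j => (lsubst (R *m P) f).@[fun k => (k == j)%:R]) e.+3.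
  rewrite {1}lsubstQ /diag_form; under [RHS]eq_bigr do rewrite alE scaler_suml.
  rewrite exchange_big /=; apply: eq_bigr => i _.
  have [j Qij] : exists j, Q i j != 0.
    have [|j] := @unitmx_col_neq0 _ _ Q^T i; first by rewrite unitmx_tr.
    by rewrite mxE; exists j.
  have Q0 k : k != j -> Q i k = 0.
    by apply: contraNeq => Qik; rewrite (rowQ _ _ _ Qik Qij).
  have -> : linform (row i Q) = Q i j *: 'X_j.
    rewrite /linform (big_only1 j) ?mxE // => k kj _.
    by rewrite mxE Q0 // scale0r.
  rewrite [RHS](big_only1 j) ?exprZn ?scalerA // => k kj _.
  by rewrite Q0 // expr0n mulr0 scale0r.
split=> /=.
- have -> : \matrix_i row i (invmx P *m invmx R) = invmx P *m invmx R.
    by apply/row_matrixP => i; rewrite rowK.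
  by rewrite row_free_unit unitmx_mul !unitmx_inv uP.
- move=> j; rewrite alE; have [i Qij] := unitmx_col_neq0 j uQ.
  rewrite (bigD1 i) //= big1 ?addr0 => [|k ki].
    by rewrite mulf_neq0 ?expf_neq0 ?a0.
  suff -> : Q k j = 0 by rewrite expr0n mulr0.
  by apply: contraNeq ki => Qkj; rewrite (colQ _ _ _ Qkj Qij).
have uRP : R *m P \in unitmx by rewrite unitmx_mul uR.
have fE : f = lsubst (invmx P *m invmx R) (lsubst (R *m P) f).
  by rewrite lsubstM -invmx_mulmx // mulmxV // lsubst1.
apply: (etrans fE); apply: (etrans (congr1 (lsubst _) fQ)).
exact: lsubst_diag_form.
Qed.

Let entryE (M : 'M[K]_n) i k : (A *m M) i k = (linform (row i A)).@[M^~ k].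
Proof. by rewrite linform_eval mxE; apply: eq_bigr => j _; rewrite mxE. Qed.

Let rowE i k : (linform (row i A)).@[(invmx A)^~ k] = (i == k)%:R.
Proof. by rewrite -entryE mulmxV // mxE. Qed.

(** The entry is the linear form [row i A] evaluated at column [k]; this form takes the value 1 at
    column [i] of [invmx A]. *)
Lemma prob_mx_entry0 i k :
  prob_mx F S (fun M => (A *m M) i k = 0) <= 1%:R / #|` S|%:R.
Proof.
apply: (prob_mx_col F S0 (k := k)) => M; exists (linform (row i A)); split.
- by apply: (@meval_neq0 _ _ _ ((invmx A)^~ i)); rewrite rowE eqxx oner_neq0.
- exact/msize_dhomog/linform_homog.
by move=> v _; rewrite entryE setcol_same.
Qed.

(** Given the first column, equality is a polynomial condition of degree [e.+1] on the second. When
    [C j (k1 hn)] is nonzero, so is the polynomial, as its value at column [i] of [invmx A] shows; a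
    zero there is charged to [prob_mx_entry0]. *)
Lemma prob_mx_eq_ratio i j : i != j ->
  prob_mx F S (fun M => let C := A *m M in
    C j (k1 hn) != 0 /\ (C i (k2 hn) * C j (k1 hn)) ^+ e.+1
                      = (C j (k2 hn) * C i (k1 hn)) ^+ e.+1)
  <= e.+1%:R / #|` S|%:R.
Proof.
move=> ij; apply: (prob_mx_col F S0 (k := k2 hn)) => M.
pose c i := (A *m M) i (k1 hn).
have cE v i' : (A *m setcol (k2 hn) v M) i' (k1 hn) = c i'.
  by rewrite !entryE setcol_other -?entryE.
have [c0|c0] := eqVneq (c j) 0.
  exists 1; split=> [||v _]; rewrite ?oner_neq0 ?msize1 //.
  by rewrite /= !cE c0 eqxx => -[].
exists ((c j *: linform (row i A)) ^+ e.+1 - (c i *: linform (row j A)) ^+ e.+1).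
have evE v : ((c j *: linform (row i A)) ^+ e.+1
    - (c i *: linform (row j A)) ^+ e.+1).@[v]
    = (c j * (linform (row i A)).@[v]) ^+ e.+1
      - (c i * (linform (row j A)).@[v]) ^+ e.+1.
  by rewrite mevalB !rmorphXn /= !mevalZ.
split=> [||v _].
- apply: (@meval_neq0 _ _ _ ((invmx A)^~ i)); rewrite evE !rowE eqxx.
  by rewrite [j == i]eq_sym (negPf ij) mulr0 mulr1 expr0n subr0 expf_neq0.
- have powH b (l : 'rV[K]_n) : (b *: linform l) ^+ e.+1 \is e.+1.-homog.
    by have := dhomogMn e.+1 (dhomogZ b (linform_homog l)); rewrite mul1n.
  exact: msize_dhomog (rpredB (powH _ _) (powH _ _)).
by rewrite /= !cE !entryE setcol_same evE mulrC [c i * _]mulrC => -[_ ->]; rewrite subrr.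
Qed.

(** Failure requires equal ratios for a pair, a singular matrix or a zero in the first column of
    [C]. The last two contribute n/|S| each, and 2n is at most n(d - 1) because d is at least 3. *)
Lemma prob_mx_outputs :
  1 - ((2 * 'C(n, 2) * e.+1)%:R / #|` S|%:R + (n * e.+2)%:R / #|` S|%:R)
  <= prob_mx F S (outputs_decomposition hn e.+3 f).
Proof.
pose B2 M := exists2 i : 'I_n, xpredT i & (A *m M) i (k1 hn) = 0.
pose B3 M := exists2 p : 'I_n * 'I_n, (p.1 < p.2)%N & let C := A *m M in
    C p.2 (k1 hn) != 0 /\ (C p.1 (k2 hn) * C p.2 (k1 hn)) ^+ e.+1
                      = (C p.2 (k2 hn) * C p.1 (k1 hn)) ^+ e.+1.
pose B M := B3 M \/ (M \notin unitmx \/ B2 M).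
apply: (@le_trans _ _ (1 - prob_mx F S B)); last first.
  apply: prob_mx_ge => // M; have [?|nB] := pselect (B M); [by right|left].
  have uM : M \in unitmx.
    by apply: contraT => uM; case: nB; right; left.
  have C1 i : (A *m M) i (k1 hn) != 0.
    by apply: contraPneq nB => C0; apply; right; right; exists i.
  have C2 (i j : 'I_n) : (i < j)%N ->
      ((A *m M) i (k2 hn) * (A *m M) j (k1 hn)) ^+ e.+1
      != ((A *m M) j (k2 hn) * (A *m M) i (k1 hn)) ^+ e.+1.
    by move=> ij; apply: contraPneq nB => C0; apply; left; exists (i, j).
  apply: good_outputs_decomposition => // i j.
  by rewrite neq_ltn => /orP[/C2 //|/C2]; rewrite eq_sym.
rewrite lerB //; apply: (le_trans (prob_mxU _ _ _ _)); apply: lerD.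
  apply: (le_trans (prob_mx_bigU _ _ _ _)).
  apply: (@le_trans _ _ (\sum_(p : 'I_n * 'I_n | (p.1 < p.2)%N)
      e.+1%:R / #|` S|%:R)).
    apply: ler_sum => -[i j] /= ij; apply: prob_mx_eq_ratio.
    by rewrite neq_ltn ij.
  rewrite sumr_const card_ord_pairs -mulrnAl -mulrnA.
  rewrite ler_wpM2r ?invr_ge0 ?ler0n // ler_nat.
  by rewrite mulnC -mulnA leq_pmull.
apply: (@le_trans _ _ (n%:R / #|` S|%:R + n%:R / #|` S|%:R)).
  apply: (le_trans (prob_mxU _ _ _ _)); apply: lerD.
    exact: prob_mx_singular.
  apply: (le_trans (prob_mx_bigU _ _ _ _)).
  apply: (@le_trans _ _ (\sum_(i < n) 1%:R / #|` S|%:R)).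
    by apply: ler_sum => i _; apply: prob_mx_entry0.
  by rewrite sumr_const card_ord mul1r mulr_natl.
rewrite -mulrDl -natrD ler_wpM2r ?invr_ge0 ?ler0n // ler_nat.
by rewrite !mulnS addnA leq_addr.
Qed.

End Acceptance.

Theorem theorem5p3 (R : realType) (K : fieldType)
    (hK : K = (R : fieldType) \/ K = (R[i]%C : fieldType))
    (n d : nat) (hn : (3 <= n)%N) (hd : (3 <= d)%N)
    (S : {fset K}) (hS : S != fset0)
    (f : {mpoly K[n]}) (hf : f \is d.-homog) :
  ((forall g, in_Pd d g -> ~ equivalent f g) ->
     1 - (2 * (d - 2))%:R / #|` S|%:R
       <= prob_mx R S (rejects hn d f)) /\
  ((exists2 g, in_Pd d g & equivalent f g) ->
     1 - ((2 * 'C(n, 2) * (d - 2))%:R / #|` S|%:R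
          + (n * (d - 1))%:R / #|` S|%:R)
       <= prob_mx R S (outputs_decomposition hn d f)).
Proof.
have K0 : [pchar K] =i pred0 by case: hK => ->; apply: pchar_num.
(* With d = e + 3, the differences d - 2 and d - 1 become successors. *)
case: d hd hf => [|[|[|e]]] // _ hf; rewrite -[(_ - 2)%N]/e.+1 -[(_ - 1)%N]/e.+2.
split=> [nPd|[g [a a0 ->] [A uA ->]]]; last exact: prob_mx_outputs.
have [L symL fL] := tens_poly_surj K0 hf.
by rewrite fL in nPd *; apply: prob_mx_rejects.
Qed.
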